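(* Let $E$ be a Banach lattice and $Y$ a Banach space. The following assertions are equivalent: (1) Each disjoint weak Banach-Saks operator $T:E\to Y$ is almost Banach-Saks. (2) One of the following assertions is valid: (a) $E'$ is order continuous; (b) $Y$ has the Banach-Saks property.
   Context: An operator is a bounded linear map; $E'$ is the topological dual of $E$, a Banach lattice under its dual norm and order. A sequence $(x_n)$ in a Banach lattice is disjoint if $|x_n|\wedge|x_m|=0$ for $n\ne m$. The Cesàro sequence of $(y_k)$ is $\left(\frac1m\sum_{k=1}^m y_k\right)_m$. An operator $T:E\to Y$ is disjoint weak Banach-Saks (respectively almost Banach-Saks) if for each disjoint weakly null sequence (respectively each norm bounded disjoint sequence) $(x_n)$ of $E$, $(T(x_n))$ has a subsequence whose Cesàro sequence is norm convergent in $Y$. A Banach space $Y$ has the Banach-Saks property if every norm bounded sequence in $Y$ has a subsequence whose Cesàro sequence is norm convergent. A Banach lattice is order continuous if $x_\alpha\downarrow 0$ implies $\|x_\alpha\|\to0$. *)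

(* Defs.v *)
From HB Require Import structures.
From mathcomp Require Import all_boot all_order all_algebra.
From mathcomp Require Import all_classical all_reals all_analysis.
Set Implicit Arguments.
Unset Strict Implicit.
Unset Printing Implicit Defensive.
Import Order.TTheory GRing.Theory Num.Theory.
Import numFieldNormedType.Exports.
Local Open Scope classical_set_scope.
Local Open Scope ring_scope.

(* The order and the lattice operations are fields of their own: MathComp's
   [Order.Lattice] cannot be joined with [CompleteNormedModule] by HB once
   [Num.RealDomain] has been declared. [`|x|] always denotes the norm; the
   lattice modulus is [modulus x] below. *)
HB.mixin Record isBanachLattice (R : realType) E
    of CompleteNormedModule R E := {
  blat_le : E -> E -> Prop ;
  blat_join : E -> E -> E ;
  blat_meet : E -> E -> E ;
  blat_le_refl : forall x, blat_le x x ;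
  blat_le_anti : forall x y, blat_le x y -> blat_le y x -> x = y ;
  blat_le_trans : forall y x z, blat_le x y -> blat_le y z -> blat_le x z ;
  blat_joinP : forall x y z,
    blat_le (blat_join x y) z <-> blat_le x z /\ blat_le y z ;
  blat_meetP : forall x y z,
    blat_le z (blat_meet x y) <-> blat_le z x /\ blat_le z y ;
  blat_leD2r : forall x y z, blat_le x y -> blat_le (x + z) (y + z) ;
  blat_leZ2l : forall (a : R) x y,
    0 <= a -> blat_le x y -> blat_le (a *: x) (a *: y) ;
  blat_norm_mono : forall x y,
    blat_le (blat_join x (- x)) (blat_join y (- y)) -> `|x| <= `|y|
}.

#[short(type="banachLatticeType")]
HB.structure Definition BanachLattice (R : realType) :=
  { E of isBanachLattice R E & CompleteNormedModule R E }.

Definition modulus (R : realType) (E : banachLatticeType R) (x : E) : E :=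
  blat_join x (- x).

Definition disjoint_seq (R : realType) (E : banachLatticeType R)
    (x : nat -> E) : Prop :=
  forall n m, n != m -> blat_meet (modulus (x n)) (modulus (x m)) = 0.

Record dual (R : realType) (E : normedModType R) := Dual {
  dual_fun :> {linear E -> R^o} ;
  dual_continuous : continuous dual_fun
}.

Definition dual0 (R : realType) (E : normedModType R) : dual E :=
  @Dual R E \0 (@cst_continuous E R^o 0).

(* The supremum is that of a nonempty bounded set, since [f] is continuous. *)
Definition dual_norm (R : realType) (E : normedModType R) (f : dual E) : R :=
  sup [set `|f x| | x in [set x : E | `|x| <= 1]].

Definition dual_le (R : realType) (E : banachLatticeType R) (f g : dual E)
    : Prop :=
  forall x : E, blat_le 0 x -> (f x : R) <= g x.

Definition directed (I : Type) (leI : I -> I -> Prop) : Prop :=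
  [/\ inhabited I,
      forall a, leI a a,
      forall a b c, leI a b -> leI b c -> leI a c &
      forall a b, exists c, leI a c /\ leI b c].

Section OrderContinuity.
Context (R : realType) (T : Type) (le : T -> T -> Prop) (zero : T)
  (norm : T -> R).

Definition net_decreases_to_zero (I : Type) (leI : I -> I -> Prop)
    (x : I -> T) : Prop :=
  [/\ forall a b, leI a b -> le (x b) (x a),
      forall a, le zero (x a) &
      forall z, (forall a, le z (x a)) -> le z zero].

Definition net_norm_null (I : Type) (leI : I -> I -> Prop) (x : I -> T)
    : Prop :=
  forall e : R, 0 < e -> exists a0, forall a, leI a0 a -> norm (x a) < e.

Definition order_continuous : Prop :=
  forall (I : Type) (leI : I -> I -> Prop) (x : I -> T),
    directed leI -> net_decreases_to_zero leI x -> net_norm_null leI x.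

End OrderContinuity.

Definition dual_order_continuous (R : realType) (E : banachLatticeType R)
    : Prop :=
  order_continuous (@dual_le R E) (@dual0 R E) (@dual_norm R E).

Definition weakly_null (R : realType) (E : normedModType R) (x : nat -> E)
    : Prop :=
  forall f : dual E, (f (x n) : R) @[n --> \oo] --> (0 : R).

(* Sequences are indexed from 0: the [m]-th term averages [y 0], ..., [y m]. *)
Definition cesaro_mean (R : realType) (V : normedModType R) (y : nat -> V)
    : nat -> V :=
  fun m => m.+1%:R^-1 *: \sum_(k < m.+1) y k.

Definition has_cesaro_cvg_subseq (R : realType) (V : normedModType R)
    (y : nat -> V) : Prop :=
  exists phi : nat -> nat, {homo phi : i j / (i < j)%N} /\
    cvgn (cesaro_mean (y \o phi)).

Definition norm_bounded_seq (R : realType) (V : normedModType R)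
    (x : nat -> V) : Prop :=
  exists M : R, forall n, `|x n| <= M.

Definition banach_saks_property (R : realType) (Y : normedModType R) : Prop :=
  forall y : nat -> Y, norm_bounded_seq y -> has_cesaro_cvg_subseq y.

Definition disjoint_weak_banach_saks (R : realType) (E : banachLatticeType R)
    (Y : normedModType R) (T : E -> Y) : Prop :=
  forall x : nat -> E, disjoint_seq x -> weakly_null x ->
    has_cesaro_cvg_subseq (T \o x).

Definition almost_banach_saks (R : realType) (E : banachLatticeType R)
    (Y : normedModType R) (T : E -> Y) : Prop :=
  forall x : nat -> E, disjoint_seq x -> norm_bounded_seq x ->
    has_cesaro_cvg_subseq (T \o x).

(* Main.v *)
Require Import Defs.
From HB Require Import structures.
From mathcomp Require Import all_boot all_order all_algebra.
From mathcomp Require Import all_classical all_reals all_analysis.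
From mathcomp Require Import lra.
Import Order.TTheory GRing.Theory Num.Theory.
Import numFieldNormedType.Exports.
Local Open Scope classical_set_scope.
Local Open Scope ring_scope.

(** The equivalence rests on one fact: the dual of [E] is order continuous if
    and only if every norm bounded disjoint sequence of [E] is weakly null.

    The basic tool is [disjoint_components]. Given a functional [f] and a
    disjoint sequence [u n >= 0], let [g n] be the component of the positive
    part of [f] carried by the ideal generated by [u n]. On the positive cone
    [g n x] is the supremum of [f] over the [y] of that ideal with
    [0 <= y <= x]; Riesz decomposition makes it additive. The [g n] are
    positive, [g n] vanishes on what is disjoint from [u n],
    [f (u n) <= g n (u n)], and the sum of the [g n x] is at most any upper
    bound of [f] on the order interval [[0, x]].

    - Order continuous dual, [order_continuous_weakly_null]: the tails [h N] of
      the series of the [g n] decrease to zero in the dual, hence in norm, while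
      [f (u N) <= h N (u N)]. So bounded disjoint sequences are weakly null, and
      each disjoint weak Banach-Saks operator is almost Banach-Saks. If [Y] has
      the Banach-Saks property, every bounded operator is almost Banach-Saks.

    - Dual not order continuous, [not_order_continuous_disjoint]: a net
      decreasing to zero but not in norm yields, by a gliding hump argument, a
      positive functional [f] and a bounded disjoint sequence [u n >= 0] with
      [f (u n)] bounded away from zero. For any bounded sequence [y] in [Y], the
      operator [T x = \sum_n (g n x / g n (u n)) *: y n] is bounded and sends
      [u n] to [y n]. It is disjoint weak Banach-Saks: the norm of [T x] is at
      most a multiple of [f (modulus x)], and [f (modulus (x n))] tends to zero
      when [x] is disjoint and weakly null, by [weakly_null_modulus]. If [T] is
      almost Banach-Saks, then [y] has a subsequence with convergent Cesaro
      means; as [y] is arbitrary, [Y] has the Banach-Saks property. *)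

Local Notation "x ⊑ y" := (blat_le x y) (at level 70, no associativity).
Local Notation "x ⊔ y" := (blat_join x y) (at level 48, left associativity).
Local Notation "x ⊓ y" := (blat_meet x y) (at level 48, left associativity).

(** * Lattice identities in a Banach lattice *)

Section Lattice.
Context {R : realType} {E : banachLatticeType R}.
Implicit Types (x y z a b u v : E) (k : R).

Lemma blat_join_ge x y : x ⊑ x ⊔ y /\ y ⊑ x ⊔ y.
Proof. exact/blat_joinP/blat_le_refl. Qed.

Lemma blat_meet_le x y : x ⊓ y ⊑ x /\ x ⊓ y ⊑ y.
Proof. exact/blat_meetP/blat_le_refl. Qed.

Lemma blat_meetC x y : x ⊓ y = y ⊓ x.
Proof.
by apply: blat_le_anti; apply/blat_meetP;
  have [? ?] := blat_meet_le x y; have [? ?] := blat_meet_le y x.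
Qed.

Lemma blat_joinC x y : x ⊔ y = y ⊔ x.
Proof.
by apply: blat_le_anti; apply/blat_joinP;
  have [? ?] := blat_join_ge x y; have [? ?] := blat_join_ge y x.
Qed.

Lemma blat_leD {x y a b} : x ⊑ y -> a ⊑ b -> x + a ⊑ y + b.
Proof.
move=> xy ab; apply: (blat_le_trans (y + a)); first exact: blat_leD2r.
by rewrite ![y + _]addrC; exact: blat_leD2r.
Qed.

Lemma blat_leBlDr x y z : (x - y ⊑ z) <-> (x ⊑ z + y).
Proof.
split=> h.
  by move: (blat_leD2r _ _ y h); rewrite subrK.
by move: (blat_leD2r _ _ (- y) h); rewrite addrK.
Qed.

Lemma blat_leBrDr x y z : (x ⊑ z - y) <-> (x + y ⊑ z).
Proof.
split=> h.
  by move: (blat_leD2r _ _ y h); rewrite subrK.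
by move: (blat_leD2r _ _ (- y) h); rewrite addrK.
Qed.

Lemma blat_subr_ge0 x y : 0 ⊑ x - y <-> y ⊑ x.
Proof. by rewrite blat_leBrDr add0r. Qed.

Lemma blat_leN2 x y : x ⊑ y -> - y ⊑ - x.
Proof. by move=> xy; apply/blat_subr_ge0; rewrite opprK addrC blat_subr_ge0. Qed.

Lemma blat_addr_ge0 {x y} : 0 ⊑ x -> 0 ⊑ y -> 0 ⊑ x + y.
Proof. by move=> x0 y0; have := blat_leD x0 y0; rewrite addr0. Qed.

Lemma blat_scale_ge0 {k x} : 0 <= k -> 0 ⊑ x -> 0 ⊑ k *: x.
Proof. by move=> k0 x0; have := blat_leZ2l k _ _ k0 x0; rewrite scaler0. Qed.

Lemma blat_scale_le {k l x} : k <= l -> 0 ⊑ x -> k *: x ⊑ l *: x.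
Proof.
move=> kl x0; apply/blat_subr_ge0; rewrite -scalerBl.
by apply: blat_scale_ge0 => //; rewrite subr_ge0.
Qed.

Lemma blat_joinDr x y z : (x + z) ⊔ (y + z) = x ⊔ y + z.
Proof.
have [h1 h2] := blat_join_ge x y; have [h3 h4] := blat_join_ge (x + z) (y + z).
apply: blat_le_anti.
  by apply/blat_joinP; split; exact: blat_leD2r.
by apply/blat_leBrDr/blat_joinP; rewrite !blat_leBrDr.
Qed.

Lemma blat_meetDr x y z : (x + z) ⊓ (y + z) = x ⊓ y + z.
Proof.
have [h1 h2] := blat_meet_le x y; have [h3 h4] := blat_meet_le (x + z) (y + z).
apply: blat_le_anti.
  by apply/blat_leBlDr/blat_meetP; rewrite !blat_leBlDr.
by apply/blat_meetP; split; exact: blat_leD2r.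
Qed.

Lemma blat_oppr_join x y : - (x ⊔ y) = (- x) ⊓ (- y).
Proof.
have [h1 h2] := blat_join_ge x y; have [h3 h4] := blat_meet_le (- x) (- y).
apply: blat_le_anti.
  by apply/blat_meetP; split; exact: blat_leN2.
rewrite -[_ ⊓ _]opprK; apply: blat_leN2; apply/blat_joinP.
by split; [rewrite -[X in X ⊑ _]opprK | rewrite -[X in X ⊑ _]opprK];
  exact: blat_leN2.
Qed.

Lemma blat_addr_join_meet x y : x ⊔ y + x ⊓ y = x + y.
Proof.
have -> : x ⊓ y = (- y) ⊓ (- x) + (x + y).
  by rewrite -blat_meetDr [- y + _]addrCA addNr addr0 addKr.
by rewrite -blat_oppr_join [y ⊔ x]blat_joinC addrA subrr add0r.
Qed.

Lemma blat_meet_ge0 {x y} : 0 ⊑ x -> 0 ⊑ y -> 0 ⊑ x ⊓ y.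
Proof. by move=> ? ?; exact/blat_meetP. Qed.

Lemma blat_disjoint_le {x y u v} : 0 ⊑ x -> 0 ⊑ y -> x ⊑ u -> y ⊑ v ->
  u ⊓ v = 0 -> x ⊓ y = 0.
Proof.
move=> x0 y0 xu yv uv; apply: blat_le_anti; last exact: blat_meet_ge0.
rewrite -uv; have [h1 h2] := blat_meet_le x y; apply/blat_meetP; split.
  exact: blat_le_trans h1 xu.
exact: blat_le_trans h2 yv.
Qed.

Lemma blat_disjointD {x y z} : 0 ⊑ x -> 0 ⊑ y -> 0 ⊑ z ->
  y ⊓ x = 0 -> z ⊓ x = 0 -> (y + z) ⊓ x = 0.
Proof.
move=> x0 y0 z0 yx zx; have yz0 := blat_addr_ge0 y0 z0.
apply: blat_le_anti; last exact: blat_meet_ge0.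
have [h1 h2] := blat_meet_le (y + z) x.
set t := _ ⊓ _ in h1 h2 *.
have tz : t ⊑ z.
  have : t - z ⊑ 0.
    rewrite -yx; apply/blat_meetP; split; first exact/blat_leBlDr.
    apply/blat_leBlDr; rewrite -[t]addr0; exact: blat_leD.
  by rewrite blat_leBlDr add0r.
by rewrite -zx; apply/blat_meetP.
Qed.

Lemma blat_meetZ {k x y} : 0 < k -> (k *: x) ⊓ (k *: y) = k *: (x ⊓ y).
Proof.
move=> k0; have k0' := lt0r_neq0 k0; have ki0 : 0 <= k^-1 by rewrite invr_ge0 ltW.
have [h1 h2] := blat_meet_le x y.
have [h3 h4] := blat_meet_le (k *: x) (k *: y).
apply: blat_le_anti; last first.
  by apply/blat_meetP; split; apply: blat_leZ2l => //; exact: ltW.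
rewrite -[X in X ⊑ _]scale1r -(divff k0') -scalerA.
apply: blat_leZ2l; first exact: ltW.
apply/blat_meetP; split.
  by have := blat_leZ2l _ _ _ ki0 h3; rewrite scalerA mulVf // scale1r.
by have := blat_leZ2l _ _ _ ki0 h4; rewrite scalerA mulVf // scale1r.
Qed.

Lemma blat_disjointZ {k l x y} : 0 <= k -> 0 <= l -> 0 ⊑ x -> 0 ⊑ y ->
  x ⊓ y = 0 -> (k *: x) ⊓ (l *: y) = 0.
Proof.
move=> k0 l0 x0 y0 xy; pose m := 1 + k + l.
have m0 : 0 < m by rewrite /m -addrA ltr_pwDl // addr_ge0.
apply: (@blat_disjoint_le _ _ (m *: x) (m *: y)); try exact: blat_scale_ge0.
- by apply: blat_scale_le => //; rewrite /m addrAC lerDr addr_ge0.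
- by apply: blat_scale_le => //; rewrite /m lerDr addr_ge0.
by rewrite blat_meetZ // xy scaler0.
Qed.

(** Disjoint minorants of a positive element can be added up. *)
Lemma blat_disjoint_addr_le {x y z} :
  y ⊓ z = 0 -> y ⊑ x -> z ⊑ x -> y + z ⊑ x.
Proof.
by move=> yz yx zx; rewrite -blat_addr_join_meet yz addr0; exact/blat_joinP.
Qed.

(** The positive part of [x]; its negative part is [ppart (- x)]. *)
Definition ppart x : E := x ⊔ 0.

Lemma ppart_ge0 x : 0 ⊑ ppart x. Proof. by have [] := blat_join_ge x 0. Qed.

Lemma ppart_ge x : x ⊑ ppart x. Proof. by have [] := blat_join_ge x 0. Qed.

Lemma ppart_least x y : x ⊑ y -> 0 ⊑ y -> ppart x ⊑ y.
Proof. by move=> ? ?; exact/blat_joinP. Qed.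

Lemma ppart_le {x y} : x ⊑ y -> ppart x ⊑ ppart y.
Proof.
move=> xy; apply: ppart_least (ppart_ge0 y); exact: blat_le_trans xy (ppart_ge y).
Qed.

Lemma ppartE x : x = ppart x - ppart (- x).
Proof.
have <- : ppart (- x) + x = ppart x.
  by rewrite /ppart -blat_joinDr addNr add0r blat_joinC.
by rewrite addrAC subrr add0r.
Qed.

Lemma ppart_disjoint x : ppart x ⊓ ppart (- x) = 0.
Proof.
have e : ppart (- x) = - x + ppart x by rewrite {2}[x]ppartE opprB subrK.
have h : 0 ⊓ (- x) = - ppart x by rewrite /ppart blat_oppr_join oppr0 blat_meetC.
by rewrite e -{1}[ppart x]add0r blat_meetDr h addNr.
Qed.

Lemma modulus_ge x : x ⊑ modulus x /\ - x ⊑ modulus x.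
Proof. exact: blat_join_ge. Qed.

Lemma modulus_ge0 x : 0 ⊑ modulus x.
Proof.
have [h1 h2] := modulus_ge x; have := blat_leD h1 h2; rewrite subrr => h.
have h20 : (0 : R) <= 2^-1 by rewrite invr_ge0.
have := blat_scale_ge0 h20 h.
by rewrite -[modulus x + _]mulr2n -(scaler_nat 2 (modulus x)) scalerA mulVf // scale1r.
Qed.

Lemma ppart_le_modulus x : ppart x ⊑ modulus x.
Proof. by apply: ppart_least (modulus_ge0 x); have [] := modulus_ge x. Qed.

Lemma modulusN x : modulus (- x) = modulus x.
Proof. by rewrite /modulus opprK blat_joinC. Qed.

Lemma modulusE x : modulus x = ppart x + ppart (- x).
Proof.
apply: blat_le_anti.
  apply/blat_joinP; split.
    rewrite -[x in X in X ⊑ _]addr0; exact: blat_leD (ppart_ge _) (ppart_ge0 _).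
  rewrite -[X in X ⊑ _]add0r; exact: blat_leD (ppart_ge0 _) (ppart_ge _).
apply: (blat_disjoint_addr_le (ppart_disjoint x) (ppart_le_modulus x)).
by rewrite -modulusN; exact: ppart_le_modulus.
Qed.

Lemma modulus_id {x} : 0 ⊑ x -> modulus x = x.
Proof.
move=> x0; apply: blat_le_anti; last by have [] := modulus_ge x.
apply/blat_joinP; split; first exact: blat_le_refl.
by apply: (blat_le_trans 0) => //; rewrite -oppr0; exact: blat_leN2.
Qed.

Lemma blat_norm_le {x y} : 0 ⊑ x -> x ⊑ y -> `|x| <= `|y|.
Proof.
move=> x0 xy; apply: blat_norm_mono.
by rewrite -!/(modulus _) !modulus_id //; exact: blat_le_trans xy.
Qed.

Lemma norm_modulus x : `|modulus x| = `|x|.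
Proof.
by apply/eqP; rewrite eq_le; apply/andP; split; apply: blat_norm_mono;
  rewrite -!/(modulus _) (modulus_id (modulus_ge0 x)); exact: blat_le_refl.
Qed.

Lemma norm_ppart_le x : `|ppart x| <= `|x|.
Proof.
by rewrite -(norm_modulus x); apply: blat_norm_le (ppart_ge0 x) (ppart_le_modulus x).
Qed.

(** The positive cone is closed: [- l <= s n - l] gives
    [`|ppart (- l)| <= `|s n - l|]. *)
Lemma blat_ge0_lim (s : nat -> E) (l : E) :
  (forall n, 0 ⊑ s n) -> s n @[n --> \oo] --> l -> 0 ⊑ l.
Proof.
move=> s0 sl; suff p0 : ppart (- l) = 0 by rewrite [l]ppartE p0 subr0; exact: ppart_ge0.
apply/eqP; rewrite -normr_eq0 eq_le normr_ge0 andbT.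
apply/ler_addgt0Pr => e e0; rewrite add0r.
have [N _ /(_ N (leqnn N)) /= h] := (cvgrPdist_lt _ _).1 sl e e0.
apply: le_trans (ltW h); rewrite distrC.
apply: le_trans (norm_ppart_le _); apply: blat_norm_le (ppart_ge0 _) _.
by apply: ppart_le; rewrite -[X in X ⊑ _]add0r; apply: blat_leD2r.
Qed.

(** The Riesz decomposition property. *)
Lemma blat_riesz {x a b} : 0 ⊑ x -> 0 ⊑ a -> 0 ⊑ b -> x ⊑ a + b ->
  exists y z, [/\ x = y + z, 0 ⊑ y, y ⊑ a, 0 ⊑ z & z ⊑ b].
Proof.
move=> x0 a0 b0 xab; have [h1 h2] := blat_meet_le x a.
exists (x ⊓ a), (x - x ⊓ a); split=> //.
- by rewrite addrC subrK.
- exact: blat_meet_ge0.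
- exact/blat_subr_ge0.
apply/blat_leBlDr; rewrite addrC -blat_leBlDr; apply/blat_meetP.
split; apply/blat_leBlDr => //.
by rewrite -[x in X in X ⊑ _]addr0; apply: blat_leD => //; exact: blat_le_refl.
Qed.

End Lattice.

(** * Bounded linear maps *)

Section BoundedLinear.
Context {R : realType} {V W : normedModType R}.

Lemma continuous_linear_bound (T : {linear V -> W}) : continuous T ->
  exists2 C : R, 0 <= C & forall x, `|T x| <= C * `|x|.
Proof.
move=> /linear_bounded_continuous/linear_boundedP [M [Mreal h]].
exists (`|M| + 1); first by rewrite addr_ge0.
by move=> x; apply: h; rewrite (le_lt_trans (ler_norm M)) // ltrDl.
Qed.

Lemma bounded_linear_ex (T : V -> W) (C : R) : linear T ->
  (forall x, `|T x| <= C * `|x|) ->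
  exists2 S : {linear V -> W}, continuous S & S =1 T.
Proof.
move=> lT TC; pose S := HB.pack_for {linear V -> W} T
  (GRing.isLinear.Build R V W *:%R T lT).
exists S => //; apply/linear_bounded_continuous/linear_boundedP.
exists C; split; first exact: num_real.
move=> r Cr x; apply: le_trans (TC x) _; exact: ler_wpM2r (ltW Cr).
Qed.

End BoundedLinear.

(** * Functionals on the positive cone *)

Section Cone.
Context {R : realType} {E : banachLatticeType R}.
Implicit Types (x y z a b u v : E) (k : R).

(** An additive, homogeneous and bounded function on the positive cone extends
    to a functional by [x |-> p (ppart x) - p (ppart (- x))]. *)
Lemma cone_extension (p : E -> R) (C : R) :
  (forall x y, 0 ⊑ x -> 0 ⊑ y -> p (x + y) = p x + p y) ->
  (forall k x, 0 <= k -> 0 ⊑ x -> p (k *: x) = k * p x) ->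
  (forall x, 0 ⊑ x -> `|p x| <= C * `|x|) ->
  exists g : dual E, forall x, 0 ⊑ x -> g x = p x.
Proof.
move=> pD pZ pC; pose q (x : E) : R^o := p (ppart x) - p (ppart (- x)).
(* [q x] can be computed from any decomposition of [x], which gives linearity
   without the lattice structure. *)
have qB x a b : 0 ⊑ a -> 0 ⊑ b -> x = a - b -> q x = p a - p b.
  move=> a0 b0 xE.
  have e : ppart x + b = a + ppart (- x).
    by rewrite -(subrK b a) -xE {2}[x]ppartE addrAC subrK.
  have := congr1 p e; rewrite !pD //; try exact: ppart_ge0.
  by move=> h; apply/eqP; rewrite /q subr_eq addrAC eq_sym subr_eq h.
have qlin : linear q.
  move=> k x y; have p0 := @ppart_ge0 R E; have [k0|k0] := leP 0 k.
    rewrite (qB _ (k *: ppart x + ppart y) (k *: ppart (- x) + ppart (- y))).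
    - rewrite !pD ?pZ //; try exact: blat_scale_ge0.
      rewrite /q /GRing.scale /= mulrBr opprD; exact: addrACA.
    - by apply: blat_addr_ge0 => //; exact: blat_scale_ge0.
    - by apply: blat_addr_ge0 => //; exact: blat_scale_ge0.
    by rewrite {1}[x]ppartE {1}[y]ppartE scalerBr opprD addrACA.
  have k0' : 0 <= - k by rewrite oppr_ge0 ltW.
  rewrite (qB _ (- k *: ppart (- x) + ppart y) (- k *: ppart x + ppart (- y))).
  - rewrite !pD ?pZ //; try exact: blat_scale_ge0.
    rewrite /q /GRing.scale /= mulrBr opprD addrACA; congr (_ + _).
    by rewrite !mulNr opprK addrC.
  - by apply: blat_addr_ge0 => //; exact: blat_scale_ge0.
  - by apply: blat_addr_ge0 => //; exact: blat_scale_ge0.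
  rewrite {1}[x]ppartE {1}[y]ppartE opprD addrACA; congr (_ + _).
  by rewrite scalerBr !scaleNr opprK addrC.
have C0 x : 0 ⊑ x -> C * `|x| <= `|C| * `|x|.
  by move=> _; apply: ler_wpM2r => //; exact: ler_norm.
have [|g gc gq] := bounded_linear_ex q (`|C| + `|C|) qlin.
  move=> x; apply: le_trans (ler_normB _ _) _; rewrite mulrDl; apply: lerD.
    apply: le_trans (pC _ (ppart_ge0 _)) _.
    apply: le_trans (C0 _ (ppart_ge0 _)) _.
    by apply: ler_wpM2l => //; exact: norm_ppart_le.
  apply: le_trans (pC _ (ppart_ge0 _)) _.
  apply: le_trans (C0 _ (ppart_ge0 _)) _.
  by apply: ler_wpM2l => //; rewrite -[leRHS]normrN; exact: norm_ppart_le.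
exists (Dual gc) => x x0 /=; rewrite gq (qB x x 0) ?subr0 //.
  have := pZ 0 0 (lexx _) (blat_le_refl _); rewrite scaler0 mul0r => ->.
  by rewrite subr0.
exact: blat_le_refl.
Qed.

Lemma dual_bound (f : dual E) :
  exists2 C : R, 0 <= C & forall x, `|f x| <= C * `|x|.
Proof. exact/continuous_linear_bound/dual_continuous. Qed.

(** The positive elements below [x] in the ideal generated by [u]. *)
Definition ideal_interval u x : set E :=
  [set y | [/\ 0 ⊑ y, y ⊑ x & exists2 k : R, 0 <= k & y ⊑ k *: u]].

(** The value at [x >= 0] of the component of the positive part of [f] carried
    by the ideal generated by [u >= 0]. *)
Definition carrier (f : dual E) u x : R :=
  sup [set (f y : R) | y in ideal_interval u x].

Lemma ideal_interval0 {u x} : 0 ⊑ u -> 0 ⊑ x -> ideal_interval u x 0.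
Proof.
move=> u0 x0; split=> //; first exact: blat_le_refl.
by exists 0 => //; rewrite scale0r; exact: blat_le_refl.
Qed.

Lemma carrier_ub (f : dual E) u x y :
  ideal_interval u x y -> f y <= carrier f u x.
Proof.
move=> yI; apply: ub_le_sup; last by exists y.
have [C C0 fC] := dual_bound f; exists (C * `|x|) => _ [z [z0 zx _] <-].
apply: le_trans (ler_norm _) _; apply: le_trans (fC z) _.
by apply: ler_wpM2l => //; exact: blat_norm_le.
Qed.

Lemma carrier_le (f : dual E) u x (b : R) : 0 ⊑ u -> 0 ⊑ x ->
  (forall y, ideal_interval u x y -> (f y : R) <= b) -> carrier f u x <= b.
Proof.
move=> u0 x0 fb; apply: ge_sup; last by move=> _ [y yI <-]; exact: fb.
by exists (f 0); exists 0 => //; exact: ideal_interval0.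
Qed.

Lemma carrier_ge0 (f : dual E) u x : 0 ⊑ u -> 0 ⊑ x -> 0 <= carrier f u x.
Proof.
by move=> u0 x0; rewrite -[0](linear0 f); exact/carrier_ub/ideal_interval0.
Qed.

Lemma carrierD (f : dual E) u x y : 0 ⊑ u -> 0 ⊑ x -> 0 ⊑ y ->
  carrier f u (x + y) = carrier f u x + carrier f u y.
Proof.
move=> u0 x0 y0; apply/eqP; rewrite eq_le; apply/andP; split.
  apply: carrier_le => //; first exact: blat_addr_ge0.
  move=> z [z0 zxy [k k0 zk]].
  have [a [b [zE a0 ax b0 bY]]] := blat_riesz z0 x0 y0 zxy.
  rewrite zE linearD; apply: lerD; apply: carrier_ub; split=> //; exists k => //.
    apply: blat_le_trans zk; rewrite zE -[a in X in X ⊑ _]addr0.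
    exact: blat_leD (blat_le_refl _) b0.
  apply: blat_le_trans zk; rewrite zE -[b in X in X ⊑ _]add0r.
  exact: blat_leD a0 (blat_le_refl _).
rewrite -lerBrDr; apply: carrier_le => // a [a0 ax [k k0 ak]].
rewrite lerBrDr -lerBrDl; apply: carrier_le => // b [b0 bY [l l0 bl]].
rewrite lerBrDl -linearD; apply: carrier_ub; split.
- exact: blat_addr_ge0.
- exact: blat_leD.
by exists (k + l); [exact: addr_ge0 | rewrite scalerDl; exact: blat_leD].
Qed.

Lemma carrierZ (f : dual E) u k x : 0 ⊑ u -> 0 <= k -> 0 ⊑ x ->
  carrier f u (k *: x) = k * carrier f u x.
Proof.
move=> u0 + x0; rewrite le_eqVlt => /predU1P[<-|k0].
  rewrite scale0r mul0r; apply/eqP; rewrite eq_le carrier_ge0 ?andbT //;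
    last exact: blat_le_refl.
  apply: carrier_le => //; first exact: blat_le_refl.
  by move=> y [y0 y0' _]; rewrite (blat_le_anti _ _ y0' y0) linear0.
have half l z : 0 < l -> 0 ⊑ z -> l * carrier f u z <= carrier f u (l *: z).
  move=> l0 z0; rewrite mulrC -ler_pdivlMr //; apply: carrier_le => //.
  move=> y [y0 yz [m m0 ym]]; rewrite ler_pdivlMr // mulrC.
  have -> : l * f y = f (l *: y) by rewrite linearZ.
  apply: carrier_ub; split.
  - exact: blat_scale_ge0 (ltW l0) _.
  - exact: blat_leZ2l (ltW l0) _.
  exists (l * m); first exact: mulr_ge0 (ltW l0) _.
  by rewrite -scalerA; apply: blat_leZ2l (ltW l0) _.
apply/eqP; rewrite eq_le half // andbT.
have ki : 0 < k^-1 by rewrite invr_gt0.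
have := half _ _ ki (blat_scale_ge0 (ltW k0) x0).
by rewrite scalerA mulVf ?gt_eqF // scale1r mulrC ler_pdivrMr // mulrC.
Qed.

Lemma ideal_interval_disjoint u v x y : 0 ⊑ u -> 0 ⊑ v -> u ⊓ v = 0 ->
  ideal_interval u x y -> forall k, 0 <= k -> y ⊓ (k *: v) = 0.
Proof.
move=> u0 v0 uv [y0 _ [l l0 yl]] k k0.
apply: (blat_disjoint_le y0 (blat_scale_ge0 k0 v0) yl (blat_le_refl _)).
exact: blat_disjointZ.
Qed.

(** The components carried by pairwise disjoint elements add up to at most the
    positive part of [f]: choosing minorants of [x] in the disjoint ideals one
    after the other, their sum stays below [x]. *)
Lemma sum_carrier_le (f : dual E) (u : nat -> E) x (b : R) N :
  (forall n, 0 ⊑ u n) -> (forall n m, n != m -> u n ⊓ u m = 0) -> 0 ⊑ x ->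
  (forall y, 0 ⊑ y -> y ⊑ x -> f y <= b) ->
  \sum_(n < N) carrier f (u n) x <= b.
Proof.
move=> u0 ud x0 fb.
(* [y] is the sum of the minorants chosen so far, disjoint from the [u n] that
   remain. *)
suff h y : 0 ⊑ y -> y ⊑ x -> (forall n, (n < N)%N -> u n ⊓ y = 0) ->
    f y + \sum_(n < N) carrier f (u n) x <= b.
  have := h 0; rewrite linear0 add0r; apply; first exact: blat_le_refl.
    by [].
  move=> n _; apply: blat_le_anti; first by have [] := blat_meet_le (u n) 0.
  exact: blat_meet_ge0 (u0 n) (blat_le_refl _).
elim: N y => [|N IH] y y0 yx yd; first by rewrite big_ord0 addr0; exact: fb.
rewrite big_ord_recr /= addrA -lerBrDl; apply: carrier_le => // z zI.
rewrite lerBrDl addrAC -linearD; have [z0 zx _] := zI.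
have zy : y ⊓ z = 0.
  have [_ _ [k k0 zk]] := zI; rewrite blat_meetC.
  apply: (blat_disjoint_le z0 y0 zk (blat_le_refl _)).
  rewrite -[y]scale1r; exact: blat_disjointZ (yd N _).
apply: IH; first exact: blat_addr_ge0.
  exact: blat_disjoint_addr_le.
move=> n nN; rewrite blat_meetC; apply: blat_disjointD => //.
  by rewrite blat_meetC; apply: yd; rewrite ltnW.
rewrite -[u n]scale1r; apply: (ideal_interval_disjoint (u N) _ x) => //.
by apply: ud; rewrite gtn_eqF.
Qed.

(** A functional [f] splits along a disjoint positive sequence [u] into
    positive functionals [g n] carried by the [u n]. *)
Lemma disjoint_components (f : dual E) (u : nat -> E) :
  (forall n, 0 ⊑ u n) -> (forall n m, n != m -> u n ⊓ u m = 0) ->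
  exists g : nat -> dual E,
  [/\ forall n x, 0 ⊑ x -> 0 <= g n x,
      forall N x (b : R), 0 ⊑ x ->
        (forall y, 0 ⊑ y -> y ⊑ x -> f y <= b) -> \sum_(n < N) g n x <= b,
      forall n, f (u n) <= g n (u n) &
      forall n x, 0 ⊑ x -> u n ⊓ x = 0 -> g n x = 0].
Proof.
move=> u0 ud; have [C C0 fC] := dual_bound f.
have ext n : exists g : dual E, forall x, 0 ⊑ x -> g x = carrier f (u n) x.
  apply: (cone_extension _ C) => [x y|k x|x x0].
  - exact: carrierD.
  - exact: carrierZ.
  rewrite ger0_norm ?carrier_ge0 //; apply: carrier_le => // y [y0 yx _].
  apply: le_trans (ler_norm _) _; apply: le_trans (fC y) _.
  by apply: ler_wpM2l => //; exact: blat_norm_le.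
have [g gE] := choice ext; exists g; split.
- by move=> n x x0; rewrite gE // carrier_ge0.
- move=> N x b x0 fb.
  under eq_bigr do rewrite gE //.
  exact: sum_carrier_le.
- move=> n; rewrite gE //; apply: carrier_ub; split=> //.
    exact: blat_le_refl.
  by exists 1 => //; rewrite scale1r; exact: blat_le_refl.
move=> n x x0 ux; apply/eqP; rewrite gE // eq_le carrier_ge0 ?andbT //.
apply: carrier_le => // y [y0 yx [k k0 yk]].
suff -> : y = 0 by rewrite linear0.
apply: blat_le_anti => //.
have <- : (k *: u n) ⊓ (1 *: x) = 0 by exact: blat_disjointZ.
by rewrite scale1r; apply/blat_meetP.
Qed.

End Cone.

(** * Operators that are sums of rank-one operators *)

Lemma abs_sum_cvg {R : realType} {V : completeNormedModType R} (v : nat -> V)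
    (B : R) : (forall N, \sum_(k < N) `|v k| <= B) ->
  exists2 l : V, (fun N => \sum_(k < N) v k) @ \oo --> l & `|l| <= B.
Proof.
move=> vB; have vc : cvgn (series v).
  apply: normed_cvg; apply: nondecreasing_is_cvgn.
    by move=> n m; apply: nondecreasing_series => k _ _; exact: normr_ge0.
  by exists B => _ [N _ <-]; have := vB N; rewrite -(big_mkord xpredT (fun k => `|v k|)).
have e : series v = (fun N => \sum_(k < N) v k).
  by apply/funext => N; rewrite /series /= big_mkord.
rewrite e in vc.
exists (limn (fun N => \sum_(k < N) v k)) => //.
apply: (cvgr_to_le (cvg_norm vc)); apply: nearW => N.
exact: le_trans (ler_norm_sum _ _ _) (vB N).
Qed.

Section SumOperator.
Context {R : realType} {E : banachLatticeType R}.
Implicit Types (x y z a b u v : E).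

Lemma dual_abs_le {f : dual E} x : (forall z, 0 ⊑ z -> 0 <= f z) ->
  `|f x| <= f (modulus x).
Proof.
move=> f0; rewrite {1}[x]ppartE modulusE linearB linearD.
apply: le_trans (ler_normB _ _) _.
by rewrite !ger0_norm //; apply: f0; exact: ppart_ge0.
Qed.

Lemma dual_mono {f : dual E} {x y} : (forall z, 0 ⊑ z -> 0 <= f z) ->
  x ⊑ y -> f x <= f y.
Proof.
by move=> f0 xy; rewrite -subr_ge0 -linearB; exact/f0/blat_subr_ge0.
Qed.

(** The operator [x |-> \sum_k g k x *: y k] for [y] bounded and a summable
    sequence [g] of positive functionals. *)
Lemma sum_operator {Y : completeNormedModType R} (g : nat -> dual E)
    (y : nat -> Y) (C M : R) :
  (forall n x, 0 ⊑ x -> 0 <= g n x) ->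
  (forall N x, 0 ⊑ x -> \sum_(n < N) g n x <= C * `|x|) ->
  (forall n, `|y n| <= M) ->
  exists T : {linear E -> Y}, [/\ continuous T,
    forall x, (fun N => \sum_(k < N) g k x *: y k) @ \oo --> T x &
    forall x (b : R), (forall N, \sum_(n < N) g n (modulus x) <= b) ->
      `|T x| <= b * M].
Proof.
move=> g0 gC yM; have M0 : 0 <= M := le_trans (normr_ge0 _) (yM 0%N).
have bound x (b : R) : (forall N, \sum_(n < N) g n (modulus x) <= b) ->
    forall N, \sum_(k < N) `|g k x *: y k| <= b * M.
  move=> gb N; apply: (@le_trans _ _ ((\sum_(n < N) g n (modulus x)) * M)).
    rewrite mulr_suml; apply: ler_sum => k _; rewrite normrZ.
    by apply: ler_pM => //; exact/dual_abs_le/g0.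
  exact: ler_wpM2r.
have gC' x N : \sum_(n < N) g n (modulus x) <= C * `|x|.
  by rewrite -norm_modulus; exact/gC/modulus_ge0.
have ex x : exists l : Y, (fun N => \sum_(k < N) g k x *: y k) @ \oo --> l.
  by have [l ? _] := abs_sum_cvg (fun k => g k x *: y k) _ (bound x _ (gC' x)); exists l.
have [T Tl] := choice ex.
have Tb x (b : R) : (forall N, \sum_(n < N) g n (modulus x) <= b) ->
    `|T x| <= b * M.
  move=> gb; have [l lc lb] := abs_sum_cvg (fun k => g k x *: y k) _ (bound x b gb).
  by rewrite (cvg_unique (@norm_hausdorff R Y) (Tl x) lc).
have lT : linear T.
  move=> k x z; apply: (cvg_unique (@norm_hausdorff R Y) (Tl (k *: x + z))) => /=.
  have -> : (fun N => \sum_(i < N) g i (k *: x + z) *: y i) =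
      (k \*: (fun N => \sum_(i < N) g i x *: y i)) +
      (fun N => \sum_(i < N) g i z *: y i).
    apply/funext => N.
    rewrite -[RHS]/(k *: (\sum_(i < N) g i x *: y i) +
      \sum_(i < N) g i z *: y i) scaler_sumr -big_split /=.
    apply: eq_bigr => i _.
    by rewrite linearP scalerA -scalerDl.
  by apply: cvgD => //; exact: cvgZl_tmp.
have [|S Sc ST] := bounded_linear_ex T (C * M) lT.
  by move=> x; apply: le_trans (Tb _ _ (gC' x)) _; rewrite mulrAC.
by exists S; split=> // x; rewrite ST //; exact: Tb.
Qed.

(** * Disjoint sequences and positive functionals *)

Lemma ppart_disjoint_seq (x : nat -> E) : disjoint_seq x ->
  forall n m, n != m -> ppart (x n) ⊓ ppart (x m) = 0.
Proof.
move=> xd n m /xd; apply: blat_disjoint_le; try exact: ppart_ge0;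
  exact: ppart_le_modulus.
Qed.

Lemma ppartN_disjoint_seq (x : nat -> E) : disjoint_seq x ->
  forall n m, ppart (x n) ⊓ ppart (- x m) = 0.
Proof.
move=> xd n m; have [->|nm] := eqVneq n m; first exact: ppart_disjoint.
have := xd n m nm; apply: blat_disjoint_le; try exact: ppart_ge0.
  exact: ppart_le_modulus.
by rewrite -modulusN; exact: ppart_le_modulus.
Qed.

Lemma disjoint_seqN (x : nat -> E) : disjoint_seq x ->
  disjoint_seq (fun n => - x n).
Proof. by move=> xd n m nm; rewrite !modulusN; exact: xd. Qed.

(** The sum of the components of [f] carried by the [ppart (x k)] is a
    functional [G] with [f (ppart (x n)) <= G (x n)]. *)
Lemma weakly_null_ppart (x : nat -> E) (f : dual E) :
  disjoint_seq x -> weakly_null x -> (forall z, 0 ⊑ z -> 0 <= f z) ->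
  (f (ppart (x n)) : R) @[n --> \oo] --> (0 : R).
Proof.
move=> xd xw f0.
have [g [g0 gf fg gd]] := disjoint_components f (fun n => ppart (x n))
  (fun n => ppart_ge0 (x n)) (ppart_disjoint_seq x xd).
have [C C0 fC] := dual_bound f.
have gC N z : 0 ⊑ z -> \sum_(n < N) g n z <= C * `|z|.
  move=> z0; apply: gf => // y y0 yz; apply: le_trans (ler_norm _) _.
  apply: le_trans (fC y) _; apply: ler_wpM2l => //; exact: blat_norm_le.
have one n : `|(fun _ : nat => 1 : R^o) n| <= 1 by rewrite normr1.
have [G [Gc GE _]] := sum_operator g (fun=> 1 : R^o) C 1 g0 gC one.
apply: (squeeze_cvgr _ (cvg_cst 0) (xw (Dual Gc))).
apply: nearW => n; rewrite f0 /=; last exact: ppart_ge0.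
(* [ppart (- x n)] is disjoint from all the [ppart (x k)], so only nonnegative
   terms occur in [G (x n)]. *)
have gE k : g k (x n) = g k (ppart (x n)).
  rewrite {1}[x n]ppartE linearB [g k (ppart (- x n))]gd ?subr0 //.
    exact: ppart_ge0.
  exact: ppartN_disjoint_seq.
apply: (cvgr_to_ge (GE (x n))); exists n.+1 => // N /= nN.
rewrite (bigD1 (Ordinal nN)) //= gE /GRing.scale /= mulr1.
rewrite -[leLHS]addr0; apply: lerD; first exact: fg.
apply: sumr_ge0 => k _.
by rewrite mulr1 gE; exact/g0/ppart_ge0.
Qed.

Lemma weakly_null_modulus (x : nat -> E) (f : dual E) :
  disjoint_seq x -> weakly_null x -> (forall z, 0 ⊑ z -> 0 <= f z) ->
  (f (modulus (x n)) : R) @[n --> \oo] --> (0 : R).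
Proof.
move=> xd xw f0; rewrite -[0]addr0.
under eq_fun do rewrite modulusE linearD.
apply: cvgD; first exact: weakly_null_ppart.
apply: (weakly_null_ppart (fun n => - x n)) => //; first exact: disjoint_seqN.
move=> h; rewrite -oppr0; under eq_fun do rewrite linearN.
by apply: cvgN; exact: xw.
Qed.

End SumOperator.

(** * Order continuity of the dual and disjoint sequences *)

Section OrderContinuousDual.
Context {R : realType} {E : banachLatticeType R}.
Implicit Types (x y z : E).

Lemma dual_norm_ub (f : dual E) x (M : R) : 0 < M -> `|x| <= M ->
  `|f x| <= dual_norm f * M.
Proof.
move=> M0 xM; rewrite -ler_pdivrMr //.
have -> : `|f x| / M = `|f (M^-1 *: x)|.
  rewrite linearZ /GRing.scale /= normrM mulrC; congr (_ * _).
  by rewrite ger0_norm // invr_ge0 ltW.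
apply: ub_le_sup.
  have [C C0 fC] := dual_bound f; exists C => _ [z /= z1 <-].
  by apply: le_trans (fC z) _; rewrite -[leRHS]mulr1; exact: ler_wpM2l.
exists (M^-1 *: x) => //=.
by rewrite normrZ ger0_norm ?invr_ge0 ?(ltW M0) // mulrC ler_pdivrMr // mul1r.
Qed.

(** The tails [h N] of the sum of the components of [f] carried by the [u n]
    decrease to zero in the dual, hence in norm, while
    [f (u N) <= h N (u N)]. *)
Lemma order_continuous_disjoint_small (f : dual E) (u : nat -> E) (M e : R) :
  dual_order_continuous E ->
  (forall n, 0 ⊑ u n) -> (forall n m, n != m -> u n ⊓ u m = 0) ->
  0 < M -> (forall n, `|u n| <= M) -> 0 < e ->
  exists N, forall n, (N <= n)%N -> f (u n) < e.
Proof.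
move=> oc u0 ud M0 uM e0.
have [g [g0 gf fg _]] := disjoint_components f u u0 ud.
have [C C0 fC] := dual_bound f.
have gC N z : 0 ⊑ z -> \sum_(n < N) g n z <= C * `|z|.
  move=> z0; apply: gf => // y y0 yz; apply: le_trans (ler_norm _) _.
  apply: le_trans (fC y) _; apply: ler_wpM2l => //; exact: blat_norm_le.
(* [t N] selects the tail of the series from the index [N] on. *)
pose t N n : R := (N <= n)%N%:R.
have t1 N n : `|t N n| <= 1.
  by rewrite /t; case: (N <= n)%N; rewrite ?normr1 // normr0.
have tail N : exists h : dual E,
    forall x, (fun m => \sum_(k < m) (g k x : R) * t N k) @ \oo --> (h x : R).
  have [T [Tc Tl _]] := sum_operator g (t N : nat -> R^o) C 1 g0 gC (t1 N).
  by exists (Dual Tc).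
have [h hl] := choice tail.
have h_mono (a b : nat) : (a <= b)%N -> dual_le (h b) (h a).
  move=> ab x x0; apply: (ler_cvg_to (hl b x) (hl a x)); apply: nearW => m.
  apply: ler_sum => k _; apply: ler_wpM2l; first exact: g0.
  by rewrite /t ler_nat; have [bk|//] := leqP b k; rewrite (leq_trans ab).
have h_ge0 a : dual_le (@dual0 R E) (h a).
  move=> x x0 /=; apply: (cvgr_to_ge (hl a x)); apply: nearW => m.
  by apply: sumr_ge0 => k _; apply: mulr_ge0; [exact: g0|rewrite /t ler0n].
have h_tail N x : h N x <= h 0%N x - \sum_(n < N) g n x.
  apply: (ler_cvg_to (hl N x) (cvgB (hl 0%N x) (cvg_cst _))).
  exists N => // m /= Nm.
  rewrite -[leRHS]/(\sum_(k < m) (g k x : R) * t 0%N k - \sum_(n < N) g n x).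
  rewrite lerBrDr (big_ord_widen m (fun n => g n x : R) Nm) [X in _ + X]big_mkcond /=.
  rewrite -big_split; apply: ler_sum => k _ /=; rewrite /t leq0n mulr1.
  by case: ltnP => _; rewrite ?mulr0 ?add0r ?mulr1 ?addr0.
have h_inf (z : dual E) : (forall a, dual_le z (h a)) -> dual_le z (@dual0 R E).
  move=> zh x x0 /=.
  suff : h 0%N x <= h 0%N x - z x by rewrite lerBrDr gerDl.
  apply: (cvgr_to_le (hl 0%N x)); apply: nearW => N.
  under eq_bigr do rewrite /t leq0n mulr1.
  rewrite lerBrDr -lerBrDl; exact: le_trans (zh N x x0) (h_tail N x).
have dir : directed (fun a b : nat => (a <= b)%N).
  split; [exact: inhabits 0%N | exact: leqnn | | ].
  - by move=> a b c; exact: leq_trans.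
  - by move=> a b; exists (maxn a b); rewrite leq_maxl leq_maxr.
have [N Nh] := oc _ _ h dir (And3 h_mono h_ge0 h_inf) _ (divr_gt0 e0 M0).
exists N => n /Nh; rewrite ltr_pdivlMr //; apply: le_lt_trans.
apply: le_trans (dual_norm_ub (h n) (u n) M M0 (uM n)).
apply: le_trans (ler_norm _); apply: le_trans (fg n) _.
apply: (cvgr_to_ge (hl n (u n))); exists n.+1 => // m /= nm.
rewrite (bigD1 (Ordinal nm)) //= {1}/t leqnn mulr1 lerDl.
by apply: sumr_ge0 => k _; apply: mulr_ge0; [exact: g0|rewrite /t ler0n].
Qed.

Lemma dual_opp (f : dual E) : exists g : dual E, forall x, g x = - f x.
Proof.
have [C C0 fC] := dual_bound f.
have [|x|T Tc TE] := bounded_linear_ex (fun x => - f x : R^o) C.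
- by move=> k x y; rewrite linearP opprD -scalerN.
- by rewrite normrN.
by exists (Dual Tc).
Qed.

Lemma order_continuous_weakly_null (x : nat -> E) :
  dual_order_continuous E -> disjoint_seq x -> norm_bounded_seq x ->
  weakly_null x.
Proof.
move=> oc xd [M xM].
have bound n : `|x n| <= `|M| + 1.
  by apply: le_trans (xM n) _; apply: le_trans (ler_norm M) _; rewrite lerDl.
have M0 : 0 < `|M| + 1 by rewrite ltr_wpDl.
have half (y : nat -> E) : disjoint_seq y -> (forall n, `|y n| <= `|M| + 1) ->
    forall f : dual E, (f (ppart (y n)) : R) @[n --> \oo] --> (0 : R).
  move=> yd yM f; have [g gE] := dual_opp f.
  have small := fun h e => order_continuous_disjoint_small h
    (fun n => ppart (y n)) _ e oc (fun n => ppart_ge0 (y n))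
    (ppart_disjoint_seq y yd) M0
    (fun n => le_trans (norm_ppart_le (y n)) (yM n)).
  apply/cvgrPdist_lt => e e0.
  have [N1 h1] := small f e e0; have [N2 h2] := small g e e0.
  exists (maxn N1 N2) => // n /=; rewrite geq_max => /andP[n1 n2].
  rewrite sub0r normrN ltr_norml h1 // andbT ltrNl -gE; exact: h2.
move=> f; rewrite -[0]subr0.
under eq_fun do rewrite [x _]ppartE linearB.
apply: cvgB; first exact: half.
apply: (half (fun n => - x n)); first exact: disjoint_seqN.
by move=> n; rewrite normrN.
Qed.

End OrderContinuousDual.

Section NotOrderContinuousDual.
Context {R : realType} {E : banachLatticeType R}.
Implicit Types (x y z u v w : E).

(** By completeness the [2^-n *: x n] have a sum, which dominates each of them. *)
Lemma blat_summable_ub (x : nat -> E) (M : R) :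
  (forall n, 0 ⊑ x n) -> (forall n, `|x n| <= M) ->
  exists w, forall n, 2^-1 ^+ n *: x n ⊑ w.
Proof.
move=> x0 xM; have M0 : 0 <= M := le_trans (normr_ge0 _) (xM 0%N).
have h0 n : 0 <= (2^-1 : R) ^+ n by rewrite exprn_ge0.
have [|w wl _] := abs_sum_cvg (fun n => 2^-1 ^+ n *: x n) (M * 2).
  move=> N; apply: (@le_trans _ _ (M * (2 - 2 * 2^-1 ^+ N))); last first.
    by apply: ler_wpM2l => //; rewrite gerBl mulr_ge0.
  (* The partial sums of [2^-n] are [2 - 2 * 2^-N]. *)
  elim: N => [|N IH]; first by rewrite big_ord0 expr0 mulr1 subrr mulr0.
  rewrite big_ord_recr /= normrZ (ger0_norm (h0 N)).
  have : 2^-1 ^+ N * `|x N| <= 2^-1 ^+ N * M by exact: ler_wpM2l.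
  rewrite exprS mulrA divff // mul1r; lra.
exists w => n; apply/blat_subr_ge0.
apply: (blat_ge0_lim (fun m =>
  \sum_(k < m + n.+1) 2^-1 ^+ k *: x k - 2^-1 ^+ n *: x n)).
  move=> m; have nm : (n < m + n.+1)%N by rewrite ltn_addl.
  rewrite (bigD1 (Ordinal nm)) //= addrAC subrr add0r.
  elim/big_ind : _ => [|y z|k _]; first exact: blat_le_refl.
    exact: blat_addr_ge0.
  exact: blat_scale_ge0.
apply: cvgB; last exact: cvg_cst.
by move: wl; rewrite -(cvg_shiftn n.+1).
Qed.

(** Up to positive factors, the two elements lie below [ppart p] and
    [ppart (- p)] for [p = x - c^-1 *: y]. *)
Lemma ppart_sub_disjoint {x y z1 z2} (c : R) : 0 < c ->
  c^-1 *: y ⊑ z1 -> c *: x ⊑ z2 ->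
  ppart (x - z1) ⊓ ppart (y - z2) = 0.
Proof.
move=> c0 yz xz; pose p := x - c^-1 *: y.
have h1 : ppart (x - z1) ⊑ 1 *: ppart p.
  rewrite scale1r; apply: ppart_le; rewrite /p.
  by apply: blat_leD; [exact: blat_le_refl | exact: blat_leN2].
have h2 : ppart (y - z2) ⊑ c *: ppart (- p).
  have cp := blat_leZ2l c _ _ (ltW c0) (ppart_ge (- p)).
  apply: ppart_least; last by apply: blat_scale_ge0 (ltW c0) (ppart_ge0 _).
  apply: blat_le_trans cp; rewrite /p opprB scalerBr scalerA divff ?gt_eqF //.
  rewrite scale1r.
  by apply: blat_leD; [exact: blat_le_refl | exact: blat_leN2].
apply: (blat_disjoint_le (ppart_ge0 _) (ppart_ge0 _) h1 h2).
by apply: (blat_disjointZ _ (ltW c0)); try exact: ppart_ge0;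
  [exact: ler01 | exact: ppart_disjoint].
Qed.

(** The pointwise infimum of a decreasing net of positive functionals is a
    functional, and a lower bound of the net; so a net decreasing to zero in the
    dual does so pointwise. *)
Lemma dual_net_pointwise (I : Type) (leI : I -> I -> Prop) (phi : I -> dual E) :
  directed leI ->
  net_decreases_to_zero (@dual_le R E) (@dual0 R E) leI phi ->
  forall x (d : R) i, 0 ⊑ x -> 0 < d -> exists2 j, leI i j & phi j x < d.
Proof.
move=> [[i0] lerr letr ledir] [mono pos0 inf0] x d i x0 d0.
pose p y : R := inf [set (phi j y : R) | j in setT].
have lb y j : 0 ⊑ y -> p y <= phi j y.
  move=> y0; apply: ge_inf; last by exists j.
  by exists 0 => _ [k _ <-]; exact: pos0.
have glb y (b : R) : (forall j, b <= phi j y) -> b <= p y.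
  move=> h; apply: lb_le_inf; first by exists (phi i0 y); exists i0.
  by move=> _ [k _ <-]; exact: h.
have [C C0 fC] := dual_bound (phi i0).
have [| |y y0|z zE] := cone_extension p C.
- move=> y z y0 z0; apply/eqP; rewrite eq_le; apply/andP; split; last first.
    by apply: glb => j; rewrite linearD; apply: lerD; exact: lb.
  rewrite -lerBlDr; apply: (glb) => j; rewrite lerBlDr [leRHS]addrC -lerBlDr.
  apply: glb => k; rewrite lerBlDr; have [l [jl kl]] := ledir j k.
  apply: le_trans (lb _ l (blat_addr_ge0 y0 z0)) _.
  by rewrite linearD [leRHS]addrC; apply: lerD; exact: mono.
- move=> k y; rewrite le_eqVlt => /predU1P[<- y0|k0 y0].
    rewrite scale0r mul0r; apply/eqP; rewrite eq_le; apply/andP; split.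
      by apply: le_trans (lb _ i0 (blat_le_refl _)) _; rewrite linear0.
    by apply: glb => j; rewrite linear0.
  have phiZ j : phi j (k *: y) = k * phi j y by rewrite linearZ.
  apply/eqP; rewrite eq_le; apply/andP; split.
    rewrite -ler_pdivrMl //; apply: glb => j; rewrite ler_pdivrMl // -phiZ.
    by apply: lb; exact: blat_scale_ge0 (ltW k0) _.
  by apply: glb => j; rewrite phiZ ler_pM2l //; exact: lb.
- rewrite ger0_norm; last by apply: glb => j; exact: pos0.
  exact: le_trans (lb y i0 y0) (le_trans (ler_norm _) (fC y)).
have : z x <= 0.
  by apply: (inf0 z) => // j y y0; rewrite zE //; exact: lb.
rewrite zE // => px; have [j jd] : exists j, phi j x < d.
  apply: contrapT => /forallNP h; have : d <= p x.
    by apply: glb => j; rewrite leNgt; apply/negP/h.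
  by rewrite leNgt (le_lt_trans px).
have [l [il jl]] := ledir i j; exists l => //.
exact: le_lt_trans (mono _ _ jl x x0) jd.
Qed.

(** If the norms of a net decreasing to zero stay above [e], then every member
    of the net is large at a positive element of the unit ball, while far
    members are small on the elements already chosen. The elements so obtained
    are made disjoint by subtracting a large multiple of the earlier ones and a
    small multiple of a common upper bound of all the [2^-n *: x n]. *)
Lemma not_order_continuous_disjoint : ~ dual_order_continuous E ->
  exists (f : dual E) (u : nat -> E) (e : R),
  [/\ forall x, 0 ⊑ x -> 0 <= f x,
      (forall n, 0 ⊑ u n) /\ (forall n m, n != m -> u n ⊓ u m = 0),
      forall n, `|u n| <= 1, 0 < e & forall n, e <= f (u n)].
Proof.
rewrite /dual_order_continuous /order_continuous.
move=> /existsNP[I /existsNP[leI /existsNP[phi /not_implyP[dir]]]].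
move=> /not_implyP[dec /existsNP[e /not_implyP[e0 /forallNP large]]].
have small := dual_net_pointwise I leI phi dir dec.
have [[i0] lerr letr ledir] := dir; have [mono pos0 inf0] := dec.
have e2 : 0 < e / 2 by rewrite divr_gt0.
(* Members of the net decrease, so each is as large as those beyond it. *)
have big i : exists x, [/\ 0 ⊑ x, `|x| <= 1 & e / 2 < phi i x].
  have /existsNP[j /not_implyP[ij /negP]] := large i; rewrite -leNgt => ej.
  have [|_ [x /= x1 <-]] := @sup_adherent _
    [set `|phi j x| | x in [set x : E | `|x| <= 1]] (e / 2) e2.
    split; first by exists `|phi j 0|; exists 0 => //=; rewrite normr0.
    have [C C0 fC] := dual_bound (phi j); exists C => _ [z /= z1 <-].
    by apply: le_trans (fC z) _; rewrite -[leRHS]mulr1; exact: ler_wpM2l.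
  rewrite -/(dual_norm (phi j)) => h; exists (modulus x).
  split; [exact: modulus_ge0 | by rewrite norm_modulus|].
  apply: lt_le_trans (mono _ _ ij _ (modulus_ge0 x)).
  apply: lt_le_trans (dual_abs_le x (pos0 j)).
  by apply: le_lt_trans h; lra.
have [X XP] := choice big.
(* [d n] compensates the factor [4 ^+ n] in the definition of [u]. *)
pose d n : R := e / 8 / 4 ^+ n.
have d0 n : 0 < d n by rewrite !divr_gt0 // exprn_gt0.
have next (s : nat * (I * E)) : exists j,
    0 ⊑ s.2.2 -> leI s.2.1 j /\ phi j s.2.2 < d s.1.
  have [s0|ns] := pselect (0 ⊑ s.2.2); last by exists i0.
  by have [j ij jd] := small _ _ s.2.1 s0 (d0 s.1); exists j.
have [J JP] := choice next.
pose st := fix st n : I * E := if n is m.+1 then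
  let j := J (m, st m) in (j, (st m).2 + X j) else (i0, 0).
(* [S n] is the sum of the [x k] for [k < n]. *)
pose S n := (st n).2; pose psi n := phi (st n.+1).1; pose x n := X (st n.+1).1.
have SS n : S n.+1 = S n + x n by [].
have x0 n : 0 ⊑ x n by have [] := XP (st n.+1).1.
have x1 n : `|x n| <= 1 by have [] := XP (st n.+1).1.
have psix n : e / 2 < psi n (x n) by have [] := XP (st n.+1).1.
have S0 n : 0 ⊑ S n.
  by elim: n => [|n IH]; [exact: blat_le_refl | rewrite SS; exact: blat_addr_ge0].
have psiS n : psi n (S n) < d n by have [] := JP (n, st n) (S0 n).
have stP n : leI i0 (st n).1.
  elim: n => [|n IH]; first exact: lerr.
  by apply: letr IH _; have [] := JP (n, st n) (S0 n).
have psi_le n z : 0 ⊑ z -> psi n z <= phi i0 z by exact: mono.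
have xS n m : (n < m)%N -> x n ⊑ S m.
  elim: m => // m IH; rewrite ltnS leq_eqVlt => /predU1P[->|nm].
    rewrite SS -[x m in X in X ⊑ _]add0r; exact: blat_leD (blat_le_refl _).
  rewrite SS -[x n]addr0; exact: blat_leD (IH nm) (x0 m).
have [w wP] := blat_summable_ub x 1 x0 x1.
have w0 : 0 ⊑ w by apply: blat_le_trans (wP 0%N); exact: blat_scale_ge0.
pose u n := ppart (x n - (4 ^+ n *: S n + 2^-1 ^+ n *: w)).
(* Finitely many terms are dropped, where [2^-n * phi i0 w] may be large. *)
have [n0 n0P] : exists n0, forall n, (n0 <= n)%N ->
    2^-1 ^+ n * phi i0 w <= e / 8.
  have z1 : `|2^-1 : R| < 1 by rewrite ger0_norm ?invr_ge0 //; lra.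
  have e8 : 0 < e / 8 by rewrite divr_gt0.
  have [N _ NP] := (cvgrPdist_lt _ _).1 (cvg_geometric (phi i0 w : R) z1) _ e8.
  exists N => n /NP /=; rewrite sub0r normrN => h.
  by rewrite mulrC (le_trans (ler_norm _)) // ltW.
have h4 n : 0 < (4 : R) ^+ n by rewrite exprn_gt0.
have h2 n : 0 < (2^-1 : R) ^+ n by rewrite exprn_gt0.
have u0 n : 0 ⊑ u n by exact: ppart_ge0.
have sub0 n : 0 ⊑ 4 ^+ n *: S n + 2^-1 ^+ n *: w.
  by apply: blat_addr_ge0; apply: blat_scale_ge0 => //; exact: ltW.
(* [u n] subtracts at least [4^-m *: x m] from [x n] since [n < m], and [u m]
   subtracts at least [4^m *: x n] from [x m]. *)
have ud n m : (n < m)%N -> u n ⊓ u m = 0.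
  move=> nm; apply: (ppart_sub_disjoint (4 ^+ m)) => //.
    rewrite -[X in X ⊑ _]add0r; apply: blat_leD.
      by apply: blat_scale_ge0 => //; exact: ltW.
    apply: (blat_le_trans (2^-1 ^+ n *: (2^-1 ^+ m *: x m))); last first.
      by apply: blat_leZ2l (wP m); exact: ltW.
    rewrite scalerA; apply: blat_scale_le => //.
    rewrite -exprD -exprVn (_ : 4^-1 = 2^-1 ^+ 2); last by rewrite expr2; lra.
    rewrite -exprM ler_wiXn2l //; first lra.
    by rewrite mul2n -addnn leq_add2r ltnW.
  rewrite -[X in X ⊑ _]addr0; apply: blat_leD.
    by apply: blat_leZ2l (xS _ _ nm); exact: ltW.
  by apply: blat_scale_ge0 => //; exact: ltW.
exists (phi i0), (fun n => u (n + n0)%N), (e / 4); split.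
- exact: pos0.
- split=> // n m; rewrite neq_ltn => /orP[nm|mn].
    by apply: ud; rewrite ltn_add2r.
  by rewrite blat_meetC; apply: ud; rewrite ltn_add2r.
- move=> n; apply: le_trans (x1 (n + n0)%N); apply: blat_norm_le => //.
  apply: ppart_least => //; apply/blat_leBlDr.
  rewrite -[x _ in X in X ⊑ _]addr0; exact: blat_leD (blat_le_refl _) _.
- by rewrite divr_gt0.
move=> n; move: (n + n0)%N (leq_addl n n0) => m n0m.
apply: le_trans (psi_le m _ (u0 m)).
have psi0 z : 0 ⊑ z -> 0 <= psi m z by exact: pos0.
apply: le_trans (dual_mono psi0 (ppart_ge _)).
have psiZ (k : R) z : psi m (k *: z) = k * psi m z by rewrite linearZ.
rewrite linearB linearD !psiZ.
have a1 : 4 ^+ m * psi m (S m) <= e / 8.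
  by rewrite mulrC -ler_pdivlMr //; exact: ltW.
have a2 : 2^-1 ^+ m * psi m w <= e / 8.
  apply: le_trans (n0P m n0m); apply: ler_wpM2l; first exact: ltW.
  exact: psi_le.
have := psix m; lra.
Qed.

End NotOrderContinuousDual.

(** * Construction of the operator and the equivalence *)

Lemma cvg0_has_cesaro_cvg_subseq {R : realType} {V : normedModType R}
    (y : nat -> V) :
  `|y n| @[n --> \oo] --> (0 : R) -> has_cesaro_cvg_subseq y.
Proof.
move=> y0; exists id; split=> //.
suff : cesaro_mean (y \o id) @ \oo --> (0 : V) by move=> h; apply: cvgP h.
apply/cvgr0Pnorm_lt => e e0.
have [N _ NP] := (cvgrPdist_lt _ _).1 (cesaro y0) e e0.
exists N => // m /= /NP; apply: le_lt_trans.
rewrite sub0r normrN /arithmetic_mean /cesaro_mean /series /=.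
rewrite normrZ normrM !ger0_norm ?invr_ge0 ?sumr_ge0 //.
by apply: ler_wpM2l; rewrite ?invr_ge0 // big_mkord; exact: ler_norm_sum.
Qed.

(** If the dual of [E] is not order continuous, every bounded sequence of [Y]
    is the image of a bounded disjoint sequence under a disjoint weak
    Banach-Saks operator. *)
Lemma bounded_seq_disjoint_image {R : realType} {E : banachLatticeType R}
    {Y : completeNormedModType R} (y : nat -> Y) :
  ~ dual_order_continuous E -> norm_bounded_seq y ->
  exists (T : {linear E -> Y}) (u : nat -> E),
  [/\ continuous T, disjoint_weak_banach_saks T, disjoint_seq u,
      norm_bounded_seq u & forall n, T (u n) = y n].
Proof.
move=> noc [M yM].
have [f [u [e [f0 [u0 ud] u1 e0 fu]]]] := not_order_continuous_disjoint noc.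
have [g [g0 gf fg gd]] := disjoint_components f u u0 ud.
have [C C0 fC] := dual_bound f.
have gC N z : blat_le 0 z -> \sum_(n < N) g n z <= C * `|z|.
  move=> z0; apply: gf => // v v0 vz; apply: le_trans (ler_norm _) _.
  apply: le_trans (fC v) _; apply: ler_wpM2l => //; exact: blat_norm_le.
have eg n : e <= g n (u n) by exact: le_trans (fu n) (fg n).
have gn0 n : 0 < g n (u n) by exact: lt_le_trans e0 (eg n).
have yM' n : `|(g n (u n))^-1 *: y n| <= e^-1 * M.
  rewrite normrZ; apply: ler_pM => //.
  rewrite ger0_norm; last by rewrite invr_ge0 ltW.
  by rewrite lef_pV2 ?posrE.
have [T [Tc Tl Tb]] := sum_operator g (fun n => (g n (u n))^-1 *: y n) C
  (e^-1 * M) g0 gC yM'.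
exists T, u; split=> //.
- move=> x xd xw; apply: cvg0_has_cesaro_cvg_subseq.
  have fx := weakly_null_modulus x f xd xw f0.
  have fxM : f (modulus (x n)) * (e^-1 * M) @[n --> \oo] --> (0 : R).
    by rewrite -[0](mul0r (e^-1 * M)); apply: cvgM fx _; exact: cvg_cst.
  apply: (squeeze_cvgr _ (cvg_cst 0) fxM); apply: nearW => n.
  rewrite normr_ge0 /=; apply: Tb => N; apply: gf; first exact: modulus_ge0.
  by move=> v _; exact: dual_mono.
- by move=> n m nm; rewrite !modulus_id //; exact: ud.
- by exists 1.
move=> n; apply: (cvg_unique (@norm_hausdorff R Y) (Tl (u n))).
apply: cvg_near_cst; exists n.+1 => // N /= nN.
rewrite (bigD1 (Ordinal nN)) //= scalerA divff ?gt_eqF // scale1r.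
rewrite big1 ?addr0 // => k kn; rewrite gd ?scale0r //.
by apply: ud; rewrite -(inj_eq val_inj) in kn.
Qed.

Theorem theorem3p22 (R : realType) (E : banachLatticeType R)
    (Y : completeNormedModType R) :
  (forall T : {linear E -> Y}, continuous T ->
     disjoint_weak_banach_saks T -> almost_banach_saks T)
  <->
  (dual_order_continuous E \/ banach_saks_property Y).
Proof.
split=> [h|[oc T Tc Tw x xd xb|bs T Tc _ x _ [M xM]]].
- have [oc|noc] := pselect (dual_order_continuous E); first by left.
  right=> y yb.
  have [T [u [Tc Tw ud ub Tu]]] := bounded_seq_disjoint_image y noc yb.
  by rewrite -(_ : T \o u = y); [exact: h | exact/funext].
- by apply: Tw => //; exact: order_continuous_weakly_null.
apply: bs; have [C C0 TC] := continuous_linear_bound T Tc.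
by exists (C * M) => n; apply: le_trans (TC _) _; exact: ler_wpM2l.
Qed.
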